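(* For every odd positive integer $n$ that is not a perfect square, $\overline{p}(n)\equiv 0\pmod 8$.
   Context: An overpartition of $n$ is a partition of $n$ in which the first occurrence of each part may be overlined; $\overline{p}(n)$ is the number of overpartitions of $n$ ($\overline{p}(0)=1$), with generating function $\prod_{n\geq1}\frac{1+q^n}{1-q^n}$. *)

(* Defs.v *)
From mathcomp Require Import all_boot.

Set Implicit Arguments.
Unset Strict Implicit.
Unset Printing Implicit Defensive.

(* A sequence of pairs (part, is it overlined?), the parts being listed in
   weakly decreasing order. *)
Definition overpartition (n : nat) (s : seq (nat * bool)) : bool :=
  let parts := unzip1 s in
  [&& sorted geq parts, all (leq 1) parts, sumn parts == n &
      [forall i : 'I_(size s),
        nth false (unzip2 s) i ==> (index (nth 0 parts i) parts == i)]].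

Definition bseq_pairs (n : nat) (s : {bseq n of 'I_n.+1 * bool}) :
    seq (nat * bool) :=
  [seq (nat_of_ord x.1, x.2) | x <- s].

(* An overpartition of n has at most n parts, each at most n, so it is no
   restriction to count among bounded sequences; see num_overpartitionsP. *)
Definition num_overpartitions (n : nat) : nat :=
  #|[set s : {bseq n of 'I_n.+1 * bool} | overpartition n (bseq_pairs s)]|.

Lemma bseq_pairs_inj n : injective (@bseq_pairs n).
Proof.
move=> s t eq_st; apply: val_inj; apply: inj_map eq_st.
by move=> [a b] [c d] [] /val_inj-> ->.
Qed.

Lemma size_sumn (s : seq nat) : all (leq 1) s -> size s <= sumn s.
Proof. by elim: s => //= x s IHs /andP[x_gt0 /IHs]; apply: (leq_add x_gt0). Qed.

Lemma mem_leq_sumn (s : seq nat) x : x \in s -> x <= sumn s.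
Proof.
elim: s => //= y s IHs; rewrite inE => /predU1P[->|/IHs le_xs].
  exact: leq_addr.
exact: leq_trans le_xs (leq_addl _ _).
Qed.

Lemma num_overpartitionsP n :
  exists l : seq (seq (nat * bool)),
    [/\ uniq l, forall s, (s \in l) = overpartition n s
      & size l = num_overpartitions n].
Proof.
pose A := [set s : {bseq n of 'I_n.+1 * bool} | overpartition n (bseq_pairs s)].
exists [seq bseq_pairs s | s <- enum A]; split.
- by rewrite (map_inj_uniq (@bseq_pairs_inj n)) enum_uniq.
- move=> s; apply/mapP/idP => [[t]|ovs].
    by rewrite mem_enum inE => ovt ->.
  have /and4P[_ pos_s /eqP sum_s _] := ovs.
  have size_s : size [seq (inord x.1 : 'I_n.+1, x.2) | x <- s] <= n.
    by rewrite size_map -(size_map fst) -sum_s size_sumn.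
  have sE : s = bseq_pairs (Bseq size_s).
    rewrite /bseq_pairs /= -map_comp -[LHS]map_id; apply/eq_in_map => -[a b] s_ab.
    rewrite /= inordK // ltnS -sum_s mem_leq_sumn //.
    by apply/mapP; exists (a, b).
  by exists (Bseq size_s); rewrite // mem_enum inE -sE.
- by rewrite size_map -cardE.
Qed.

(* Main.v *)
Require Import Defs.
From mathcomp Require Import all_boot.
From mathcomp Require Import zify.

(* Weigh each partition of n by 2 to the number of its distinct part sizes:
   modulo 8 only the partitions with one or two part sizes survive. The former
   are the divisors of n, and there are 2 M of them, with M the number of
   divisors below sqrt n. The latter are the solutions of a x + b y = n with
   a > b, and conjugation acts on them as (a, b, x, y) |-> (x + y, x, b, a - b);
   its fixed points are the factorizations n = x (x + 2 y), of which there are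
   M because n is odd. Hence the count is 4 M + 4 M modulo 8. *)

Set Implicit Arguments.
Unset Strict Implicit.
Unset Printing Implicit Defensive.

(** * Involutions on a duplicate-free list *)

Section Involution.

Variables (T : eqType) (s : seq T) (f : T -> T).
Hypotheses (s_uniq : uniq s) (f_stable : {in s, forall x, f x \in s}).
Hypothesis f_invol : {in s, involutive f}.

(** [f] itself carries the elements whose rank it raises bijectively onto those whose rank it
    lowers. *)
Lemma count_ltn_involution (r : T -> nat) :
  count (fun x => r (f x) < r x) s = count (fun x => r x < r (f x)) s.
Proof.
rewrite -!size_filter -[RHS](size_map f); apply/perm_size/uniq_perm.
- exact: filter_uniq.
- rewrite map_inj_in_uniq ?filter_uniq // => x y.
  rewrite !mem_filter => /andP[_ sx] /andP[_ sy] fxy.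
  by rewrite -(f_invol sx) fxy f_invol.
move=> x; apply/idP/mapP => [|[y]]; rewrite mem_filter => /andP[lt_r s_x].
  by exists (f x); rewrite ?f_invol // mem_filter f_invol ?lt_r ?f_stable.
by move=> ->; rewrite mem_filter f_invol ?lt_r ?f_stable.
Qed.

(** The non-fixed elements split into two equal halves. As [T] carries no order, the position in [s]
    serves as an injective rank. *)
Lemma odd_size_involution : odd (size s) = odd (count (fun x => f x == x) s).
Proof.
pose r x := index x s.
have -> : size s = count (fun x => f x == x) s
    + (count (fun x => r x < r (f x)) s).*2.
  (* One copy of the doubled count becomes the count of lowered elements; then each element is
     fixed, raised or lowered, exactly one of the three. *)
  rewrite -addnn -{2}(count_ltn_involution r) -sum1_size -!sum1_count.
  rewrite [in RHS]big_mkcond [X in _ + (X + _)]big_mkcond [X in _ + (_ + X)]big_mkcond.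
  rewrite -!big_split /=.
  rewrite !big_seq; apply: eq_bigr => x sx.
  case: eqVneq => [->|fx_x]; first by rewrite ltnn.
  have : r (f x) != r x.
    by apply: contra_neq fx_x => /index_inj; apply; rewrite ?f_stable.
  by case: ltngtP.
by rewrite oddD odd_double addbF.
Qed.

End Involution.

(** * Overlinings as masks below the mask of first occurrences *)

Fixpoint submasks (c : bitseq) : seq bitseq :=
  if c is b :: c' then
    map (cons false) (submasks c') ++
    (if b then map (cons true) (submasks c') else [::])
  else [:: [::]].

Lemma size_submasks c : size (submasks c) = 2 ^ count id c.
Proof.
by elim: c => //= -[] c IHc; rewrite size_cat !size_map IHc ?addn0 // addnn -mul2n expnS.
Qed.

Lemma mem_cons_map (T : eqType) (x y : T) s l :
  (x :: s \in map (cons y) l) = (x == y) && (s \in l).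
Proof.
apply/mapP/andP => [[t lt [-> ->]]|[/eqP-> sl]]; first by rewrite eqxx.
by exists s.
Qed.

Lemma mem_submasks c f : (f \in submasks c) = all2 implb f c.
Proof.
elim: c f => [|b c IHc] [|x f] //=.
  by rewrite mem_cat; apply/negP => /orP[/mapP[]//|]; case: b => // /mapP[].
rewrite mem_cat mem_cons_map IHc.
by case: b => //=; rewrite ?mem_cons_map ?IHc; case: x; rewrite /= ?orbF.
Qed.

Lemma submasks_uniq c : uniq (submasks c).
Proof.
elim: c => //= b c IHc.
rewrite cat_uniq map_inj_uniq ?IHc /=; last by move=> ? ? [].
case: b => //=; rewrite map_inj_uniq ?IHc ?andbT; last by move=> ? ? [].
by apply/hasPn => _ /mapP[f _ ->]; rewrite mem_cons_map.
Qed.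

Definition first_occ (p : seq nat) : bitseq :=
  mkseq (fun i => index (nth 0 p i) p == i) (size p).

(** Induction from the right: appending an entry keeps the earlier bits and adds a true bit exactly
    when the entry is new. *)
Lemma count_first_occ p : count id (first_occ p) = size (undup p).
Proof.
elim/last_ind: p => // p x IHp.
have -> : first_occ (rcons p x) = rcons (first_occ p) (x \notin p).
  rewrite /first_occ size_rcons mkseqS; congr rcons.
    apply/eq_in_map => i; rewrite mem_iota /= add0n => lt_ip.
    by rewrite nth_rcons lt_ip -cats1 index_cat mem_nth.
  rewrite nth_rcons ltnn eqxx -cats1 index_cat.
  case: ifP => [xp|_] /=; last by rewrite eqxx addn0 eqxx.
  by apply/negbTE; rewrite neq_ltn index_mem xp.
rewrite -cats1 count_cat IHp.
have /perm_undup/perm_size-> : rcons p x =i x :: p by move=> y; rewrite mem_rcons.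
by rewrite /=; case: (x \in p) => /=; rewrite ?addn0 ?addn1.
Qed.

Definition is_partition n p := [&& sorted geq p, all (leq 1) p & sumn p == n].

Lemma overpartition_zip n p f : size f = size p ->
  overpartition n (zip p f) = is_partition n p && (f \in submasks (first_occ p)).
Proof.
move=> size_f; rewrite /overpartition unzip1_zip ?size_f // unzip2_zip ?size_f //.
rewrite /is_partition -!andbA; do 3!congr andb.
rewrite mem_submasks all2E size_mkseq size_f eqxx /=.
apply/forallP/(all_nthP (false, false)) => /= [H i|H i].
  rewrite size2_zip ?size_mkseq ?size_f // => lt_ip.
  have lt_iz : i < size (zip p f) by rewrite size1_zip ?size_f.
  rewrite nth_zip ?size_mkseq ?size_f //= nth_mkseq //.
  exact: H (Ordinal lt_iz).
have lt_ip : i < size p by rewrite -(@size1_zip _ _ p f) ?size_f.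
have := H i; rewrite [size (zip f _)]size2_zip ?size_mkseq ?size_f // => /(_ lt_ip).
by rewrite nth_zip ?size_mkseq ?size_f //= nth_mkseq.
Qed.

(** Overpartitions are grouped by their underlying partition [p]; the fibre over [p] is
    [submasks (first_occ p)]. *)
Lemma num_overpartitions_sum n :
  exists P : seq (seq nat), [/\ uniq P, forall p, (p \in P) = is_partition n p
    & num_overpartitions n = \sum_(p <- P) 2 ^ size (undup p)].
Proof.
have [l [l_uniq mem_l <-]] := num_overpartitionsP n.
pose P := undup (map unzip1 l).
have P_uniq : uniq P by exact: undup_uniq.
have size_sub p f : f \in submasks (first_occ p) -> size f = size p.
  by rewrite mem_submasks all2E size_mkseq => /andP[/eqP].
have overE s : overpartition n s = is_partition n (unzip1 s)
    && (unzip2 s \in submasks (first_occ (unzip1 s))).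
  by rewrite -overpartition_zip ?zip_unzip // !size_map.
have mem_P p : (p \in P) = is_partition n p.
  rewrite mem_undup; apply/mapP/idP => [[s]|p_part].
    by rewrite mem_l overE => /andP[? _] ->.
  (* Overlining nothing shows that every partition underlies some overpartition. *)
  exists (zip p (nseq (size p) false)); last by rewrite unzip1_zip ?size_nseq.
  rewrite mem_l overpartition_zip ?size_nseq // p_part mem_submasks all2E.
  rewrite size_mkseq size_nseq eqxx /=; apply/allP => -[x y] /(map_f fst) /=.
  by rewrite -/unzip1 unzip1_zip ?size_nseq ?size_mkseq // mem_nseq => /andP[_ /eqP->].
exists P; split=> //.
under eq_bigr do rewrite -count_first_occ -size_submasks.
rewrite -(big_map (fun p => size (submasks (first_occ p))) predT id) -sumnE.
rewrite -(size_allpairs_dep (fun p f => zip p f)).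
apply/perm_size/uniq_perm => //.
  apply: allpairs_uniq_dep => // [p _|]; first exact: submasks_uniq.
  move=> _ _ /allpairsPdep[p [f [_ pf ->]]] /allpairsPdep[q [g [_ qg ->]]] /= e.
  have sf := size_sub _ _ pf; have sg := size_sub _ _ qg.
  have epq : p = q.
    by rewrite -(@unzip1_zip _ _ p f) ?sf // e unzip1_zip ?sg.
  have efg : f = g.
    by rewrite -(@unzip2_zip _ _ p f) ?sf // e unzip2_zip ?sg.
  by rewrite epq efg.
move=> s; rewrite mem_l; apply/idP/allpairsPdep.
  rewrite overE => /andP[sP sf].
  by exists (unzip1 s), (unzip2 s); rewrite mem_P zip_unzip.
move=> [p [f [Pp pf ->]]].
by rewrite (overpartition_zip _ (size_sub _ _ pf)) -mem_P Pp.
Qed.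

(** * Partitions with exactly two part sizes *)

Definition two_block (q : nat * nat * nat * nat) : seq nat :=
  let: (a, b, x, y) := q in nseq x a ++ nseq y b.

Definition two_block_data (p : seq nat) : nat * nat * nat * nat :=
  (head 0 p, last 0 p, count_mem (head 0 p) p, count_mem (last 0 p) p).

Definition two_part n (q : nat * nat * nat * nat) :=
  let: (a, b, x, y) := q in [&& 0 < b < a, 0 < x, 0 < y & a * x + b * y == n].

(** The Ferrers diagram of [x] rows of length [a] and [y] rows of length [b] has [b] columns of
    height [x + y] and [a - b] columns of height [x]. *)
Definition conj_two (q : nat * nat * nat * nat) :=
  let: (a, b, x, y) := q in (x + y, x, b, a - b).

Lemma sorted_nseq_cat x a y b : b <= a -> sorted geq (nseq x a ++ nseq y b).
Proof.
move=> le_ba; have path_b c : b <= c -> path geq c (nseq y b).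
  by elim: y c => //= y IHy c ->; apply: IHy.
case: x => [|x] /=.
  by have := path_b b (leqnn b); case: (y) => //= k /andP[].
by elim: x => [|x IHx] /=; rewrite ?path_b // leqnn.
Qed.

(** Both blocks are nonempty, so [head] and [last] never return their default 0, and [a != b] keeps
    the two multiplicities apart. *)
Lemma two_block_dataK n q : two_part n q -> two_block_data (two_block q) = q.
Proof.
case: q => [[[a b] x] y] /and4P[/andP[b_gt0 lt_ba] x_gt0 y_gt0 _].
have hE : head 0 (two_block (a, b, x, y)) = a by case: x x_gt0.
have lE : last 0 (two_block (a, b, x, y)) = b.
  by case: y y_gt0 {hE} => // y _; rewrite /= last_cat /=; elim: y => //.
rewrite /two_block_data hE lE /= !count_cat !count_nseq /= !eqxx.
by rewrite (gtn_eqF lt_ba) (ltn_eqF lt_ba) !mul1n !mul0n addn0.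
Qed.

Lemma two_block_partition n q : two_part n q ->
  is_partition n (two_block q) /\ size (undup (two_block q)) = 2.
Proof.
case: q => [[[a b] x] y] /and4P[/andP[b_gt0 lt_ba] x_gt0 y_gt0 /eqP sum_n].
split.
  rewrite /is_partition sorted_nseq_cat ?(ltnW lt_ba) //= all_cat !all_nseq.
  rewrite b_gt0 (leq_trans b_gt0 (ltnW lt_ba)) !orbT /=.
  by rewrite sumn_cat !sumn_nseq sum_n.
suff /perm_size-> : perm_eq (undup (two_block (a, b, x, y))) [:: a; b] by [].
apply: uniq_perm; rewrite ?undup_uniq //= ?inE ?andbT ?(gtn_eqF lt_ba) //.
by move=> z; rewrite mem_undup mem_cat !mem_nseq x_gt0 y_gt0 !inE.
Qed.

Lemma two_block_surj n p : is_partition n p -> size (undup p) = 2 ->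
  exists2 q, two_part n q & p = two_block q.
Proof.
move=> /and3P[p_sorted p_pos /eqP p_sum] size_p.
have [a [b [lt_ba mem_p]]] : exists a b, b < a /\ p =i [:: a; b].
  have := undup_uniq p; have memE z : (z \in p) = (z \in undup p).
    by rewrite mem_undup.
  case: (undup p) size_p memE => [|u [|v []]] //= _ memE.
  rewrite inE andbT => neq_uv.
  have [lt_uv|lt_vu|eq_uv] := ltngtP u v; last by rewrite eq_uv eqxx in neq_uv.
    by exists v, u; split=> // z; rewrite memE !inE orbC.
  by exists u, v; split=> // z; rewrite memE !inE.
have pE : p = two_block (a, b, count_mem a p, count_mem b p).
  (* Two weakly decreasing lists with the same multiplicities coincide. *)
  apply: (@sorted_eq _ geq) => //.
  - by move=> ? ? ? /= h1 h2; apply: leq_trans h2 h1.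
  - by move=> ? ? /= h; apply: anti_leq; rewrite andbC.
  - by apply: sorted_nseq_cat; apply: ltnW.
  apply/allP => z _ /=; rewrite count_cat !count_nseq /=; apply/eqP.
  have [<-|neq_az] := eqVneq a z; first by rewrite (ltn_eqF lt_ba) mul1n mul0n addn0.
  have [<-|neq_bz] := eqVneq b z; first by rewrite mul1n.
  by apply/count_memPn; rewrite mem_p !inE ![z == _]eq_sym negb_or neq_az.
exists (a, b, count_mem a p, count_mem b p) => //.
rewrite /two_part lt_ba -!has_count !has_pred1 !mem_p !inE !eqxx orbT /=.
have -> /= : 0 < b by apply: (allP p_pos); rewrite mem_p !inE eqxx orbT.
by rewrite -p_sum {3}pE /= sumn_cat !sumn_nseq.
Qed.

(** * Counting by divisors: one part size, then two *)

Lemma count_one_part n P : 0 < n -> uniq P ->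
    (forall p, (p \in P) = is_partition n p) ->
  count (fun p => size (undup p) == 1) P = size (divisors n).
Proof.
move=> n_gt0 P_uniq mem_P.
rewrite -size_filter -(size_map (fun d => nseq (n %/ d) d) (divisors n)).
apply/perm_size/uniq_perm; first exact: filter_uniq.
  rewrite map_inj_in_uniq ?divisors_uniq // => d e.
  rewrite -!dvdn_divisors // => d_n e_n.
  have : 0 < n %/ d by rewrite divn_gt0 ?(dvdn_leq n_gt0 d_n) ?(dvdn_gt0 n_gt0 d_n).
  have : 0 < n %/ e by rewrite divn_gt0 ?(dvdn_leq n_gt0 e_n) ?(dvdn_gt0 n_gt0 e_n).
  (* Both constant lists are nonempty, so their heads can be compared. *)
  by case: (n %/ d) => // k; case: (n %/ e) => // m _ _ [].
move=> p; rewrite mem_filter mem_P; apply/andP/mapP.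
  move=> [/eqP size_p /and3P[_ p_pos /eqP p_sum]].
  have [a mem_p] : exists a, p =i [:: a].
    have memE z : (z \in p) = (z \in undup p) by rewrite mem_undup.
    by case: (undup p) size_p memE => [|a []] // _ memE; exists a.
  have pE : p = nseq (size p) a.
    by apply/all_pred1P/allP => z; rewrite mem_p inE.
  have a_gt0 : 0 < a by apply: (allP p_pos); rewrite mem_p inE.
  have nE : n = a * size p by rewrite -p_sum {1}pE sumn_nseq.
  by exists a; rewrite -?dvdn_divisors // nE ?dvdn_mulr // mulKn.
move=> [d]; rewrite -dvdn_divisors // => d_n ->.
have d_gt0 := dvdn_gt0 n_gt0 d_n.
have nd_gt0 : 0 < n %/ d by rewrite divn_gt0 // (dvdn_leq n_gt0 d_n).
split.
  apply/eqP; suff /perm_size-> : perm_eq (undup (nseq (n %/ d) d)) [:: d] by [].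
  apply: uniq_perm; rewrite ?undup_uniq //.
  by move=> z; rewrite mem_undup mem_nseq nd_gt0 inE.
rewrite /is_partition -[nseq _ _]cats0 (@sorted_nseq_cat _ _ 0 d) //= cats0.
by rewrite all_nseq d_gt0 orbT sumn_nseq mulnC divnK //=.
Qed.

(** The map [d |-> n %/ d] exchanges the divisors below and above the square root, and a fixed
    divisor would make [n] a square. *)
Lemma size_divisors_nonsquare n : 0 < n -> (~ exists k, n = k ^ 2) ->
  size (divisors n) = (count (fun d => d < n %/ d) (divisors n)).*2.
Proof.
move=> n_gt0 n_nsq.
have divE d : d \in divisors n -> d * (n %/ d) = n.
  by rewrite -dvdn_divisors // mulnC => /divnK.
have stable : {in divisors n, forall d, n %/ d \in divisors n}.
  by move=> d /divE dE; rewrite -dvdn_divisors // -{2}dE dvdn_mull.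
have invol : {in divisors n, involutive (fun d => n %/ d)}.
  move=> d /divE dE; rewrite -{1}dE mulnK // lt0n.
  by apply: contraTneq n_gt0 => nd0; rewrite -dE nd0 muln0.
have lt_gt := count_ltn_involution (divisors_uniq n) stable invol id.
rewrite -addnn -{2}lt_gt -(count_predC (fun d => d < n %/ d)); congr addn.
apply: eq_in_count => d /divE dE /=.
rewrite -leqNgt leq_eqVlt; case: eqVneq => // dd.
by case: n_nsq; exists d; rewrite -dE dd.
Qed.

Lemma odd_count_two_parts n P : odd n -> uniq P ->
    (forall p, (p \in P) = is_partition n p) ->
  odd (count (fun p => size (undup p) == 2) P)
    = odd (count (fun d => d < n %/ d) (divisors n)).
Proof.
move=> n_odd P_uniq mem_P; have n_gt0 := odd_gt0 n_odd.
pose Q := [seq two_block_data p | p <- P & size (undup p) == 2].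
have mem_Q q : (q \in Q) = two_part n q.
  apply/mapP/idP => [[p]|q_two].
    rewrite mem_filter mem_P => /andP[/eqP size_p p_part] ->.
    have [r r_two ->] := two_block_surj p_part size_p.
    by rewrite (two_block_dataK r_two).
  have [q_part size_q] := two_block_partition q_two.
  by exists (two_block q); rewrite ?mem_filter ?mem_P ?size_q ?(two_block_dataK q_two).
have Q_uniq : uniq Q.
  rewrite map_inj_in_uniq ?filter_uniq // => p r.
  rewrite !mem_filter !mem_P => /andP[/eqP p2 p_part] /andP[/eqP r2 r_part].
  have [u u_two ->] := two_block_surj p_part p2.
  have [v v_two ->] := two_block_surj r_part r2.
  by rewrite (two_block_dataK u_two) (two_block_dataK v_two) => ->.
have -> : count (fun p => size (undup p) == 2) P = size Q.
  by rewrite size_map size_filter.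
rewrite (@odd_size_involution _ Q conj_two) //; first last.
- move=> [[[a b] x] y]; rewrite mem_Q => /and4P[/andP[_ lt_ba] _ _ _] /=.
  (* Since [b < a], the truncated subtraction is exact: [b + (a - b) = a]. *)
  by rewrite (subnKC (ltnW lt_ba)) addKn.
- move=> [[[a b] x] y]; rewrite !mem_Q /= => /and4P[/andP[? ?] ? ? /eqP <-].
  (* The weight is kept: [(x + y) * b + x * (a - b) = a * x + b * y]. *)
  apply/and4P; split; [lia | lia | lia | apply/eqP; nia].
congr odd; rewrite -!size_filter.
(* A fixed point has [x = b] and [a = b + y], so [n = b * (b + 2 * y)]. Setting [d = b] and
   [e = b + 2 * y] and solving for [a] and [y] gives [g]. *)
pose g d := let e := n %/ d in ((e + d)./2, d, d, (e - d)./2).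
rewrite -[RHS](size_map g); apply/perm_size/uniq_perm.
- exact: filter_uniq.
- by rewrite map_inj_uniq ?filter_uniq ?divisors_uniq // => d e [].
move=> [[[a b] x] y]; rewrite mem_filter mem_Q; apply/andP/mapP.
  move=> [/eqP[aE bE _ _] /and4P[/andP[b_gt0 lt_ba] _ y_gt0 /eqP sum_n]].
  subst x a; have nE : n = b * (b + y.*2) by nia.
  have ndE : n %/ b = b + y.*2 by rewrite nE mulKn.
  exists b; last by rewrite /g ndE; congr (_, _, _, _); lia.
  rewrite mem_filter ndE -dvdn_divisors // nE dvdn_mulr // andbT; lia.
move=> [d]; rewrite mem_filter -dvdn_divisors // => /andP[lt_d d_n] [-> -> -> ->].
have d_gt0 := dvdn_gt0 n_gt0 d_n.
have := divnK d_n; move: (n %/ d) lt_d => e lt_d nE.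
(* Oddness of [n] enters here: [d] and [e] are both odd, so the halves in [g] are exact. *)
have [e_odd d_odd] : odd e /\ odd d by move: n_odd; rewrite -nE oddM => /andP.
have [k eE] : exists k, e = d + k.*2.
  by exists (e - d)./2; lia.
subst e; have -> : (d + k.*2 + d)./2 = d + k by lia.
have -> : (d + k.*2 - d)./2 = k by lia.
by split; [rewrite /= addKn | apply/and4P; split; [lia | lia | lia | apply/eqP; nia]].
Qed.

Theorem theorem1p9 (n : nat) (n_odd : odd n)
  (n_nsq : ~ exists k : nat, n = k ^ 2) :
  num_overpartitions n = 0 %[mod 8].
Proof.
have [P [P_uniq mem_P ->]] := num_overpartitions_sum n.
have n_gt0 := odd_gt0 n_odd.
have N1 := count_one_part n_gt0 P_uniq mem_P.
have N2 := odd_count_two_parts n_odd P_uniq mem_P.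
rewrite (size_divisors_nonsquare n_gt0 n_nsq) in N1.
have sumE : \sum_(p <- P) 2 ^ size (undup p)
    = 2 * count (fun p => size (undup p) == 1) P
      + 4 * count (fun p => size (undup p) == 2) P %[mod 8].
  rewrite -!sum1_count !big_distrr /= !(big_mkcond (fun p => _ == _)) -big_split /=.
  (* As [n] is positive, no partition is empty, which rules out the weight [2 ^ 0]. *)
  have : all (fun p => 0 < size (undup p)) P.
    apply/allP => p; rewrite mem_P => /and3P[_ _ /eqP p_sum].
    case: p p_sum => [n0|a p _]; first by rewrite -n0 in n_gt0.
    by rewrite -has_predT; apply/hasP; exists a; rewrite ?mem_undup ?mem_head.
  elim: (P) => [|p s IHs]; first by rewrite !big_nil.
  rewrite !big_cons /= => /andP[p_gt0 /IHs s_mod].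
  rewrite -modnDm s_mod modnDm -[LHS]modnDml -[RHS]modnDml; congr ((_ + _) %% _).
  (* Exponents 1 and 2 match the two counts; from 3 on the weight is a multiple of 8. *)
  case: (size (undup p)) p_gt0 => [|[|[|k]]] // _.
  by rewrite !expnS !mulnA /= mulnC modnMl.
(* The total is [4 * (M + N)] modulo 8, and [M] and [N] have the same parity. *)
rewrite sumE N1; move: N2; set M := count _ (divisors n); set N := count _ P.
by move=> odd_NM; lia.
Qed.
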